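(* Let $A \in \mathbb{P}_{2n}(\mathbb{R})$ and let $\mathscr{U}$ be a $2k$-dimensional symplectic subspace of $\mathbb{R}^{2n}$. If $\mathscr{U}$ is an invariant subspace of $JA$, then there exists a symplectic basis $\{u_1,\ldots,u_k,v_1,\ldots,v_k\}$ of $\mathscr{U}$ such that $(u_1,v_1),\ldots,(u_k,v_k)$ are symplectic eigenvector pairs of $A$ corresponding to some symplectic eigenvalues $\gamma_1\leq\cdots\leq\gamma_k$ of $A$.
   Context: $\mathbb{P}_{2n}(\mathbb{R})$ is the set of $2n\times 2n$ real symmetric positive definite matrices. $J = \begin{pmatrix} 0 & I_n \\ -I_n & 0\end{pmatrix}$, and $\langle\cdot,\cdot\rangle$ is the Euclidean inner product on $\mathbb{R}^{2n}$. $\operatorname{Sp}(2n)$ is the set of real $2n\times 2n$ matrices $M$ with $M^TJM=J$. By Williamson's theorem, for $A\in\mathbb{P}_{2n}(\mathbb{R})$ there is $M\in\operatorname{Sp}(2n)$ such that $M^TAM = D\oplus D$ with $D$ an $n\times n$ diagonal matrix with positive diagonal entries $d_1(A)\le\cdots\le d_n(A)$; these numbers are uniquely determined by $A$ and are called the symplectic eigenvalues of $A$. A pair $(u,v)$ of non-zero vectors in $\mathbb{R}^{2n}$ is a symplectic eigenvector pair of $A$ corresponding to a symplectic eigenvalue $d$ of $A$ if $Au = d\,Jv$ and $Av = -d\,Ju$; here $(u_i,v_i)$ corresponds to $\gamma_i$. A subspace $\mathscr{U}$ of $\mathbb{R}^{2n}$ is a symplectic subspace if for every non-zero $u\in\mathscr{U}$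 there exists $v\in\mathscr{U}$ with $\langle u,Jv\rangle\neq 0$. A symplectic basis of a $2k$-dimensional symplectic subspace $\mathscr{U}$ is a basis $\{u_1,\ldots,u_k,v_1,\ldots,v_k\}$ of $\mathscr{U}$ with $\langle u_i,Jv_i\rangle=1$ for all $i$ and $\langle u_i,Jv_j\rangle=\langle u_i,Ju_j\rangle=\langle v_i,Jv_j\rangle=0$ for all $i\ne j$. *)

(* Defs.v *)
From HB Require Import structures.
From mathcomp Require Import all_boot all_order all_algebra.
From mathcomp Require Import reals.

Set Implicit Arguments.
Unset Strict Implicit.
Unset Printing Implicit Defensive.

Import Order.TTheory GRing.Theory Num.Theory.

Local Open Scope ring_scope.

(* Vectors of R^(2n) are columns 'cV[R]_(n + n); writing 2n as n + n gives the
   n + n block decomposition. *)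

Definition inner (R : realType) (m : nat) (u v : 'cV[R]_m) : R :=
  (u^T *m v) 0 0.

Definition posdefmx (R : realType) (m : nat) (A : 'M[R]_m) : Prop :=
  A^T = A /\ forall x : 'cV[R]_m, x != 0 -> 0 < inner x (A *m x).

Definition Jmx (R : realType) (n : nat) : 'M[R]_(n + n) :=
  block_mx 0 1%:M (- 1%:M) 0.

Arguments Jmx {R n}.

Definition Sp (R : realType) (n : nat) (M : 'M[R]_(n + n)) : Prop :=
  M^T *m Jmx *m M = Jmx.

(* Williamson's theorem: every positive definite A has exactly one symplectic
   spectrum d, listed in nondecreasing order with multiplicities. *)
Definition symplectic_spectrum (R : realType) (n : nat) (A : 'M[R]_(n + n))
    (d : n.-tuple R) : Prop :=
  [/\ sorted <=%R d,
      forall i : 'I_n, 0 < tnth d i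
    & exists M : 'M[R]_(n + n), Sp M /\
        let D := diag_mx (\row_(i < n) tnth d i) in
        M^T *m A *m M = block_mx D 0 0 D].

Definition symplectic_eigenvalue (R : realType) (n : nat) (A : 'M[R]_(n + n))
    (c : R) : Prop :=
  exists d : n.-tuple R, symplectic_spectrum A d /\ c \in d.

Definition symplectic_eigenpair (R : realType) (n : nat) (A : 'M[R]_(n + n))
    (c : R) (u v : 'cV[R]_(n + n)) : Prop :=
  [/\ u != 0, v != 0,
      A *m u = c *: (Jmx *m v)
    & A *m v = - c *: (Jmx *m u)].

Definition symplectic_subspace (R : realType) (n : nat)
    (U : {vspace 'cV[R]_(n + n)}) : Prop :=
  forall u : 'cV[R]_(n + n), u \in U -> u != 0 ->
    exists2 v : 'cV[R]_(n + n), v \in U & inner u (Jmx *m v) != 0.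

Definition invariant_subspace (R : realType) (m : nat)
    (U : {vspace 'cV[R]_m}) (B : 'M[R]_m) : Prop :=
  forall x : 'cV[R]_m, x \in U -> B *m x \in U.

Definition symplectic_basis (R : realType) (n k : nat)
    (U : {vspace 'cV[R]_(n + n)}) (u v : k.-tuple 'cV[R]_(n + n)) : Prop :=
  [/\ basis_of U (u ++ v),
      forall i : 'I_k, inner (tnth u i) (Jmx *m tnth v i) = 1
    & forall i j : 'I_k, i != j ->
        [/\ inner (tnth u i) (Jmx *m tnth v j) = 0,
            inner (tnth u i) (Jmx *m tnth u j) = 0
          & inner (tnth v i) (Jmx *m tnth v j) = 0]].

(* Main.v *)
(* Since J A is skew for the inner product <x, A y>, a complex eigenvector
   x + i y of its restriction to U has a purely imaginary eigenvalue; up to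
   sign and scaling, (x, y) is then a normalized symplectic eigenvector pair.
   The vectors w of U with <x, J w> = <y, J w> = 0 form again an invariant
   subspace, of codimension at most 2, so induction applies.  With U the whole
   space this gives Williamson's theorem, and an eigenpair for a positive c,
   written in the coordinates of a Williamson basis, forces d_i ^ 2 = c ^ 2
   for some i. *)
Require Import Defs.
From HB Require Import structures.
From mathcomp Require Import all_boot all_order all_algebra.
From mathcomp Require Import reals.
From mathcomp Require Import perm complex zify ring lra.

Set Implicit Arguments.
Unset Strict Implicit.
Unset Printing Implicit Defensive.

Import Order.TTheory GRing.Theory Num.Theory.

Local Open Scope ring_scope.

(** * The Euclidean inner product and the algebra of [Jmx] *)

Section InnerProduct.
Variables (R : realType) (m : nat).
Implicit Types (x y z : 'cV[R]_m) (c : R) (B : 'M[R]_m).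

Lemma innerC x y : inner x y = inner y x.
Proof. by rewrite /inner -[in LHS](trmxK y) -trmx_mul mxE. Qed.

Lemma innerDl x y z : inner (x + y) z = inner x z + inner y z.
Proof. by rewrite /inner linearD mulmxDl mxE. Qed.

Lemma innerZl c x y : inner (c *: x) y = c * inner x y.
Proof. by rewrite /inner linearZ -scalemxAl mxE. Qed.

Lemma innerDr x y z : inner x (y + z) = inner x y + inner x z.
Proof. by rewrite innerC innerDl !(innerC x). Qed.

Lemma innerZr c x y : inner x (c *: y) = c * inner x y.
Proof. by rewrite innerC innerZl innerC. Qed.

Lemma inner_mull B x y : inner (B *m x) y = inner x (B^T *m y).
Proof. by rewrite /inner trmx_mul mulmxA. Qed.

Lemma posdefmx_inner_ge0 B x : posdefmx B -> 0 <= inner x (B *m x).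
Proof.
move=> hB; have [->|/(hB.2 x)/ltW//] := eqVneq x 0.
by rewrite /inner mulmx0 mulmx0 mxE.
Qed.

End InnerProduct.

Lemma tr_Jmx (R : realType) n : (Jmx : 'M[R]_(n + n))^T = - Jmx.
Proof.
by rewrite /Jmx tr_block_mx opp_block_mx !trmx0 linearN /= !trmx1 !oppr0 opprK.
Qed.

Lemma mulJJ (R : realType) n : Jmx *m Jmx = - 1%:M :> 'M[R]_(n + n).
Proof.
rewrite /Jmx mulmx_block !mul0mx !mulmx0 !mul1mx !mulmx1 !add0r !addr0.
by rewrite (scalar_mx_block n n) opp_block_mx !oppr0.
Qed.

Lemma mulJK (R : realType) n m (B : 'M[R]_(n + n, m)) : Jmx *m (Jmx *m B) = - B.
Proof. by rewrite mulmxA mulJJ mulNmx mul1mx. Qed.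

Lemma inner_Jskew (R : realType) n (x y : 'cV[R]_(n + n)) :
  inner x (Jmx *m y) = - inner y (Jmx *m x).
Proof.
by rewrite innerC inner_mull tr_Jmx mulNmx -scaleN1r innerZr mulN1r.
Qed.

Lemma inner_Jself (R : realType) n (x : 'cV[R]_(n + n)) :
  inner x (Jmx *m x) = 0.
Proof. by have := inner_Jskew x x; lra. Qed.

Lemma inner_Jsym0 (R : realType) n (x y : 'cV[R]_(n + n)) :
  inner x (Jmx *m y) = 0 -> inner y (Jmx *m x) = 0.
Proof. by move=> xy; rewrite inner_Jskew xy oppr0. Qed.

(** * Real invariant planes obtained from complex eigenvectors *)

Lemma real_eigenplane (R : realType) d (C : 'M[R]_d.+1) :
  exists a b (x y : 'rV[R]_d.+1), [/\ (x != 0) || (y != 0),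
    x *m C = a *: x - b *: y & y *m C = b *: x + a *: y].
Proof.
pose CC := map_mx (@real_complex R) C.
have /closed_rootP[l] : size (char_poly CC) != 1 by rewrite size_char_poly.
rewrite -eigenvalue_root_char => /eigenvalueP[z zC z0].
(* With [l] = a + ib and [z] = x + iy, the two equations are the real and imaginary parts of
   [z *m CC = l *: z]. *)
exists (complex.Re l), (complex.Im l), (map_mx (@complex.Re R) z),
  (map_mx (@complex.Im R) z); split.
- apply: contraNT z0; rewrite negb_or !negbK => /andP[/eqP hx /eqP hy].
  apply/eqP/rowP => i; apply/eqP; rewrite eq_complex mxE /=.
  move/rowP/(_ i): hx; move/rowP/(_ i): hy; rewrite !mxE => -> ->.
  by rewrite !eqxx.
- apply/rowP => i; move/rowP/(_ i)/(congr1 (@complex.Re R)): zC.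
  rewrite !mxE raddf_sum /= => e; transitivity (complex.Re (l * z 0 i)).
    rewrite -e; apply: eq_bigr => j _; rewrite !mxE.
    by case: (z 0 j) => p q /=; ring.
  by case: (l) => p q; case: (z 0 i).
- apply/rowP => i; move/rowP/(_ i)/(congr1 (@complex.Im R)): zC.
  rewrite !mxE raddf_sum /= => e; transitivity (complex.Im (l * z 0 i)).
    rewrite -e; apply: eq_bigr => j _; rewrite !mxE.
    by case: (z 0 j) => p q /=; ring.
  by case: (l) => p q; case: (z 0 i) => p' q' /=; ring.
Qed.

(** The restriction of [B] to [U] is written as a matrix [C] in a basis of [U]. Coordinates are
    rows, so [f] intertwines right multiplication by [C] with [B]; being injective, it carries the
    eigenplane of [C] into [U]. *)
Lemma invariant_eigenplane (R : realType) m (U : {vspace 'cV[R]_m})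
    (B : 'M[R]_m) : invariant_subspace U B -> (0 < \dim U)%N ->
  exists a b (x y : 'cV[R]_m), [/\ x \in U, y \in U, (x != 0) || (y != 0),
    B *m x = a *: x - b *: y & B *m y = b *: x + a *: y].
Proof.
move=> hB; case E : (\dim U) => [//|d] _.
have [X hX] : exists X : d.+1.-tuple 'cV[R]_m, basis_of U X.
  by rewrite -E; exists (vbasis U); exact: vbasisP.
have XU i : X`_i \in U.
  have [h|h] := ltnP i (size X); last by rewrite nth_default ?mem0v.
  by rewrite -(span_basis hX) memv_span ?mem_nth.
pose f (x : 'rV[R]_d.+1) := \sum_i x 0 i *: X`_i.
pose C := \matrix_(i, j) coord X j (B *m X`_(i : 'I_d.+1)).
have fU x : f x \in U by apply: memv_suml => i _; rewrite memvZ.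
have fC x : B *m f x = f (x *m C).
  rewrite mulmx_sumr; under eq_bigr => i _.
    rewrite -scalemxAr (coord_basis hX (hB _ (XU i))) scaler_sumr; over.
  rewrite exchange_big; apply: eq_bigr => j _; rewrite mxE scaler_suml.
  by apply: eq_bigr => i _; rewrite scalerA mxE.
have fD x y : f (x + y) = f x + f y.
  by rewrite -big_split; apply: eq_bigr => i _; rewrite mxE scalerDl.
have fZ c x : f (c *: x) = c *: f x.
  by rewrite scaler_sumr; apply: eq_bigr => i _; rewrite mxE scalerA.
have f0 x : x != 0 -> f x != 0.
  apply: contraNN => /eqP fx; apply/eqP/rowP => i; rewrite mxE.
  exact: (freeP (basis_free hX) _ fx i).
have [a [b [x [y [h hx hy]]]]] := real_eigenplane C.
exists a, b, (f x), (f y); split=> //.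
- by case/orP: h => /f0->; rewrite ?orbT.
- by rewrite fC hx fD -!scaleNr !fZ.
- by rewrite fC hy fD !fZ.
Qed.

(** The size [k] is not tied to the dimension of [U]: the vectors need only lie in [U], so a system
    of a smaller subspace can be extended inside [U]. Linear independence follows from the pairings,
    see [system_free]. *)
Definition williamson_system (R : realType) n k (A : 'M[R]_(n + n))
    (U : {vspace 'cV[R]_(n + n)}) (u v : 'I_k -> 'cV[R]_(n + n))
    (g : 'I_k -> R) : Prop :=
  [/\ forall i, [/\ u i \in U, v i \in U & 0 < g i],
      forall i, A *m u i = g i *: (Jmx *m v i) /\
                A *m v i = - g i *: (Jmx *m u i)
    & forall i j, [/\ inner (u i) (Jmx *m v j) = (i == j)%:R,
        inner (u i) (Jmx *m u j) = 0 & inner (v i) (Jmx *m v j) = 0]].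

(** * Normalized eigenvector pairs in invariant subspaces *)

Section PositiveDefinite.
Variables (R : realType) (n : nat) (A : 'M[R]_(n + n)).
Hypothesis hA : posdefmx A.

Let inner_A (x y : 'cV_(n + n)) : inner (A *m x) y = inner x (A *m y).
Proof. by rewrite inner_mull hA.1. Qed.

Lemma posdefmx_ker (x : 'cV_(n + n)) : A *m x = 0 -> x = 0.
Proof.
move=> Ax; apply/eqP; apply: contraT => /hA.2.
by rewrite Ax /inner mulmx0 mxE ltxx.
Qed.

Lemma exists_normalized_pair (U : {vspace 'cV[R]_(n + n)}) :
  invariant_subspace U (Jmx *m A) -> (0 < \dim U)%N ->
  exists u v g, [/\ [/\ u \in U, v \in U & 0 < g], A *m u = g *: (Jmx *m v),
    A *m v = - g *: (Jmx *m u) & inner u (Jmx *m v) = 1].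
Proof.
move=> hinv /(invariant_eigenplane hinv)[a [b [x [y [xU yU xy0 hx hy]]]]].
have skew z : inner z (A *m (Jmx *m A *m z)) = 0.
  by rewrite -inner_A -mulmxA inner_Jself.
(* Apply [skew] to [x] and [y] and add: the cross terms in [b] cancel by symmetry of [A], leaving
   [a] times a positive number. *)
have a0 : a = 0.
  have := skew x; have := skew y.
  rewrite hx hy !mulmxDr mulmxN -!scalemxAr !innerDr -scaleN1r !innerZr.
  rewrite (_ : inner y (A *m x) = inner x (A *m y)); last first.
    by rewrite -inner_A innerC.
  have : 0 < inner x (A *m x) + inner y (A *m y).
    have hx0 := posdefmx_inner_ge0 x hA; have hy0 := posdefmx_inner_ge0 y hA.
    by case/orP: xy0 => /hA.2 h; lra.
  move=> pos ey ex; have /eqP : a * (inner x (A *m x) + inner y (A *m y)) = 0.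
    by lra.
  by rewrite mulf_eq0 (gt_eqF pos) orbF => /eqP.
move: hx hy; rewrite {}a0 !scale0r sub0r addr0 -!mulmxA => hx hy.
have JAker (z : 'cV_(n + n)) : Jmx *m (A *m z) = 0 -> z = 0.
  move=> /(congr1 (mulmx Jmx)); rewrite mulJK mulmx0 => /eqP.
  by rewrite oppr_eq0 => /eqP/posdefmx_ker.
have b0 : b != 0.
  apply: contraTN xy0 => /eqP b0; move: hx hy; rewrite b0 !scale0r oppr0.
  by move=> /JAker-> /JAker->; rewrite eqxx.
have x0 : x != 0.
  apply: contraTN xy0 => /eqP x0; move: hx; rewrite x0 !mulmx0 eqxx /= => /eqP.
  by rewrite eq_sym oppr_eq0 scaler_eq0 (negPf b0) /= => ->.
(* Moving the sign of [b] into [y] makes the eigenvalue [g] positive. *)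
pose g := `|b|; pose y' := Num.sg b *: y.
have g0 : 0 < g by rewrite normr_gt0.
have {}hx : A *m x = g *: (Jmx *m y').
  rewrite -[LHS]opprK -(mulJK (A *m x)) hx mulmxN opprK -!scalemxAr scalerA.
  by rewrite mulrC -numEsg.
have {}hy : A *m y' = - g *: (Jmx *m x).
  rewrite -[LHS]opprK -(mulJK (A *m y')) -!scalemxAr hy -scalemxAr.
  by rewrite scalerA -normrEsg scaleNr.
have y'U : y' \in U by rewrite memvZ.
clearbody g y'; pose t := inner x (Jmx *m y').
(* Positivity of <x, A x> = g t lets both vectors be divided by the square root of [t]. *)
have t0 : 0 < t.
  by have := hA.2 x x0; rewrite hx innerZr -/t pmulr_rgt0.
pose s := (Num.sqrt t)^-1.
exists (s *: x), (s *: y'), g; split.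
- by rewrite !memvZ.
- by rewrite -!scalemxAr hx !scalerA mulrC.
- by rewrite -!scalemxAr hy !scalerA mulrC.
- rewrite -scalemxAr innerZl innerZr -/t mulrA -expr2 exprVn sqr_sqrtr ?ltW//.
  by rewrite mulVf ?gt_eqF.
Qed.

(** Induction on [k]. A lower bound on the dimension suffices as hypothesis, and it is what survives
    the passage to the complement [W] of the first pair. *)
Lemma exists_williamson_system k (U : {vspace 'cV[R]_(n + n)}) :
  invariant_subspace U (Jmx *m A) -> (2 * k <= \dim U)%N ->
  exists u v g, @williamson_system R n k A U u v g.
Proof.
elim: k U => [|k IH] U hinv hdim.
  by exists (fun=> 0), (fun=> 0), (fun=> 0); split; case.
have [|u0 [v0 [g0 [[u0U v0U g0_gt0] Au0 Av0 uv0]]]] :=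
  exists_normalized_pair hinv; first by lia.
(* The two rows of [M] are the forms <u0, J w> and <v0, J w>, so [W] is their common kernel in
   [U]. *)
pose M := col_mx (u0^T *m Jmx) (v0^T *m Jmx).
pose f : 'Hom('cV[R]_(n + n), 'cV[R]_(1 + 1)) := linfun (mulmx M).
pose W := (U :&: lker f)%VS.
have WP w : reflect
    [/\ w \in U, inner u0 (Jmx *m w) = 0 & inner v0 (Jmx *m w) = 0] (w \in W).
  rewrite memv_cap memv_ker lfunE /= /M (mul_col_mx (u0^T *m _)).
  rewrite -!(mulmxA _ Jmx w).
  apply: (iffP andP) => [[-> /eqP h]|[-> hu hv]]; split=> //.
  - rewrite /inner -(col_mxKu (u0^T *m _) (v0^T *m (Jmx *m w))) h.
    by rewrite linear0 mxE.
  - rewrite /inner -(col_mxKd (u0^T *m (Jmx *m w)) (v0^T *m _)) h.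
    by rewrite linear0 mxE.
  - apply/eqP/colP => i; rewrite !mxE; case: (split i) => j; rewrite ord1.
    + exact: hu.
    + exact: hv.
(* <u0, J J A w> = - <A u0, w> is a multiple of <J v0, w>, which vanishes on [W]; likewise with [u0]
   and [v0] exchanged. *)
have hinvW : invariant_subspace W (Jmx *m A).
  move=> w /WP[wU uw vw]; apply/WP; split; first exact: hinv.
  - rewrite -mulmxA mulJK -scaleN1r innerZr -inner_A Au0 innerZl innerC.
    by rewrite (inner_Jsym0 vw) !mulr0.
  - rewrite -mulmxA mulJK -scaleN1r innerZr -inner_A Av0 innerZl innerC.
    by rewrite (inner_Jsym0 uw) !mulr0.
(* Rank-nullity: the image of [U] under [f] has dimension at most 2. *)
have hdimW : (2 * k <= \dim W)%N.
  have := limg_ker_dim f U; have := dimvS (subvf (f @: U)%VS).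
  rewrite dimvf dim_matrix -/W => le2 /esym dimU; move: hdim; rewrite dimU.
  by move: (\dim W) (\dim (f @: U)%VS) le2 => a b; lia.
have [u [v [g [hU hA' hJ]]]] := IH W hinvW hdimW.
pose ext (T : Type) (z : T) (h : 'I_k -> T) (i : 'I_k.+1) :=
  if unlift ord0 i is Some j then h j else z.
exists (ext _ u0 u), (ext _ v0 v), (ext _ g0 g); split.
- move=> i; rewrite /ext; case: unliftP => [j|] _ //.
  by have [/WP[? _ _] /WP[? _ _] ?] := hU j.
- by move=> i; rewrite /ext; case: unliftP.
- have orth j : [/\ inner u0 (Jmx *m u j) = 0, inner v0 (Jmx *m u j) = 0,
      inner u0 (Jmx *m v j) = 0 & inner v0 (Jmx *m v j) = 0].
    by have [/WP[_ ? ?] /WP[_ ? ?] _] := hU j.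
  move=> i j; rewrite /ext.
  case: unliftP => [i'|] ->; case: unliftP => [j'|] ->.
  + by rewrite (inj_eq lift_inj); exact: hJ.
  + have [h1 h2 h3 h4] := orth i'.
    rewrite (inner_Jsym0 h1) (inner_Jsym0 h2) (inner_Jsym0 h4).
    by rewrite eq_sym (negPf (neq_lift _ _)).
  + by have [-> _ -> ->] := orth j'; rewrite (negPf (neq_lift _ _)).
  + by rewrite eqxx !inner_Jself uv0.
Qed.

End PositiveDefinite.

Lemma williamson_system_sorted (R : realType) n k (A : 'M[R]_(n + n))
    (U : {vspace 'cV[R]_(n + n)}) (u v : 'I_k -> 'cV[R]_(n + n)) g :
  williamson_system A U u v g -> exists u' v' (g' : k.-tuple R),
    williamson_system A U u' v' (tnth g') /\ sorted <=%R g'.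
Proof.
move=> [hU hA hJ]; pose t := [tuple g i | i < k].
(* The permutation that sorts [g] also reindexes [u] and [v]. *)
have /tuple_permP[p hp] : perm_eq (sort <=%R t) t by rewrite perm_sort.
exists (u \o p), (v \o p), (sort_tuple <=%R t); split; last first.
  exact/sort_sorted/le_total.
have gE i : tnth (sort_tuple <=%R t) i = g (p i).
  by rewrite (tnth_nth 0) /= hp -tnth_nth !tnth_mktuple.
split=> [i|i|i j] /=; rewrite ?gE //.
by have := hJ (p i) (p j); rewrite (inj_eq perm_inj).
Qed.

(** * The matrix whose columns are the vectors of a system *)

Section SystemMatrix.
Variables (R : realType) (n k : nat) (A : 'M[R]_(n + n)).
Variables (U : {vspace 'cV[R]_(n + n)}) (u v : 'I_k -> 'cV[R]_(n + n)).
Variable (g : 'I_k -> R).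
Hypothesis hs : williamson_system A U u v g.

Let P : 'M[R]_(n + n, k) := \matrix_(i, j) u j i 0.
Let Q : 'M[R]_(n + n, k) := \matrix_(i, j) v j i 0.
Let M := row_mx P Q.
Let D := diag_mx (\row_i g i).

Let tr_mulE m (x y : 'I_k -> 'cV[R]_m) (B : 'M[R]_m) i j :
  ((\matrix_(a, b) x b a 0)^T *m (B *m \matrix_(a, b) y b a 0)) i j
  = inner (x i) (B *m y j).
Proof.
rewrite /inner !mxE; apply: eq_bigr => a _; rewrite !mxE; congr (_ * _).
by apply: eq_bigr => b _; rewrite !mxE.
Qed.

(** The entries are the pairings of the system. The left [Jmx] has size 2n and the right one size
    2k; for k = n this is membership in [Sp]. *)
Lemma system_mx_symplectic : M^T *m Jmx *m M = Jmx.
Proof.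
case: hs => _ _ hJ.
rewrite -mulmxA mul_mx_row tr_row_mx mul_col_row; congr block_mx;
  apply/matrixP => i j; rewrite tr_mulE !mxE; have [h1 h2 h3] := hJ i j => //.
by have [h _ _] := hJ j i; rewrite inner_Jskew h eq_sym.
Qed.

Lemma system_mx_diag : M^T *m A *m M = block_mx D 0 0 D.
Proof.
case: hs => _ hA hJ.
rewrite -mulmxA mul_mx_row tr_row_mx mul_col_row; congr block_mx;
  apply/matrixP => i j; rewrite tr_mulE !mxE; have [h1 h2 h3] := hJ i j;
  have [hu hv] := hA j; rewrite ?hu ?hv innerZr.
- by rewrite h1 mulr_natr; have [->|//] := eqVneq i j.
- by rewrite h2 mulr0.
- by rewrite h3 mulr0.
- have [h _ _] := hJ j i; rewrite inner_Jskew h eq_sym mulrNN mulr_natr.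
  by have [->|//] := eqVneq i j.
Qed.

(** A relation with coefficients x means M x = 0, hence J x = M^T J M x = 0, and J is invertible. *)
Lemma system_free : free ([tuple u i | i < k] ++ [tuple v i | i < k]).
Proof.
apply/(@freeP _ _ _ [tuple of _ ++ _]) => c hc i.
pose x := \col_i c i.
have Mx : M *m x = 0.
  rewrite -hc; apply/colP => a; rewrite mxE summxE; apply: eq_bigr => b _.
  rewrite -tnth_nth [x b 0]mxE [RHS]mxE mulrC -[b]splitK; case: (split b) => b' /=.
    by rewrite tnth_lshift tnth_mktuple row_mxEl !mxE.
  by rewrite tnth_rshift tnth_mktuple row_mxEr !mxE.
have : Jmx *m (Jmx *m x) = 0.
  by rewrite -{2}system_mx_symplectic -(mulmxA _ M) Mx !mulmx0.
by rewrite mulJK => /eqP; rewrite oppr_eq0 => /eqP/colP/(_ i); rewrite !mxE.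
Qed.

End SystemMatrix.

(** * Williamson's theorem and membership in the spectrum *)

Lemma williamson (R : realType) n (A : 'M[R]_(n + n)) :
  posdefmx A -> exists d, symplectic_spectrum A d.
Proof.
move=> hA; have [||u [v [g hs]]] := @exists_williamson_system _ _ _ hA n fullv.
- by move=> x _; rewrite memvf.
- by rewrite dimvf dim_matrix mulr1 mul2n addnn.
have [u' [v' [d [hd sd]]]] := williamson_system_sorted hs.
exists d; split=> // [i|]; first by have [/(_ i)[]] := hd.
exists (row_mx (\matrix_(i, j) u' j i 0) (\matrix_(i, j) v' j i 0)); split.
  exact: system_mx_symplectic hd.
exact: system_mx_diag hd.
Qed.

Lemma eigenpair_mem_spectrum (R : realType) n (A : 'M[R]_(n + n)) d c u v :
  symplectic_spectrum A d -> 0 < c -> symplectic_eigenpair A c u v -> c \in d.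
Proof.
move=> [_ d0 [M [sM /= dM]]] c0 [u0 _ Au Av].
pose D := diag_mx (\row_i tnth d i).
have M_unit : M \in unitmx.
  have : - Jmx *m M^T *m Jmx *m M = 1%:M.
    by rewrite -!mulmxA mulNmx !(mulmxA M^T) sM mulJJ opprK.
  by move/mulmx1_unit => [].
pose w := invmx M *m u; pose z := invmx M *m v.
have uE : u = M *m w by rewrite mulKVmx.
have vE : v = M *m z by rewrite mulKVmx.
(* Since M^T J M = J, the pair equations keep their form in the coordinates [w], [z], with D + D as
   a block sum in place of [A]. *)
have Dw : block_mx D 0 0 D *m w = c *: (Jmx *m z).
  rewrite -dM -!mulmxA -uE Au vE -scalemxAr.
  by rewrite -{2}sM -!mulmxA.
have Dz : block_mx D 0 0 D *m z = - c *: (Jmx *m w).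
  rewrite -dM -!mulmxA -vE Av uE -scalemxAr.
  by rewrite -{2}sM -!mulmxA.
apply: contraNT u0 => cd; rewrite uE.
(* The two relations give (d_i^2 - c^2) p = 0. Here d_i + c > 0, and d_i differs from [c] because
   [c] is assumed outside [d]. *)
have cancel i (p q : R) : tnth d i * p = c * q -> tnth d i * q = c * p -> p = 0.
  move=> hp hq; have : (tnth d i - c) * (tnth d i + c) * p = 0.
    rewrite -subr_sqr mulrBl !expr2 -!mulrA hp -hq.
    by rewrite [c * (_ * _)]mulrCA subrr.
  move/eqP; rewrite !mulf_eq0 subr_eq0 [_ + _ == _]gt_eqF ?addr_gt0// orbF.
  by case/orP => /eqP // dc; move: cd; rewrite -dc mem_tnth.
move: Dw Dz; rewrite -[w]vsubmxK -[z]vsubmxK /Jmx !mul_block_col.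
rewrite !mul0mx !mul1mx !mulNmx !mul1mx !add0r !addr0 !scale_col_mx !scaleNr.
rewrite !scalerN opprK => /eq_col_mx[e1 e2] /eq_col_mx[e3 e4].
have coord (x y : 'cV[R]_n) i : D *m x = y -> tnth d i * x i 0 = y i 0.
  by move=> <-; rewrite mul_diag_mx !mxE.
(* For w = (w1, w2) and z = (z1, z2) the block equations decouple into systems for (w1, z2) and for
   (w2, -z1), each of the shape treated by [cancel]. *)
suff [-> ->] : usubmx w = 0 /\ dsubmx w = 0 by rewrite col_mx0 mulmx0.
split; apply/colP => i; rewrite [RHS]mxE.
- apply: (cancel i _ (dsubmx z i 0)).
    by rewrite (coord _ _ i e1) mxE.
  by rewrite (coord _ _ i e4) mxE.
- apply: (cancel i _ (- usubmx z i 0)).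
    by rewrite (coord _ _ i e2) !mxE mulrN.
  by rewrite mulrN (coord _ _ i e3) !mxE opprK.
Qed.

Theorem proposition2 (R : realType) (n k : nat) (A : 'M[R]_(n + n))
    (U : {vspace 'cV[R]_(n + n)})
    (hA : posdefmx A)
    (hU : symplectic_subspace U)
    (hk : \dim U = (2 * k)%N)
    (hinv : invariant_subspace U (Jmx *m A)) :
  exists (u v : k.-tuple 'cV[R]_(n + n)) (gamma : k.-tuple R),
    [/\ symplectic_basis U u v,
        sorted <=%R gamma
      & forall i : 'I_k,
          symplectic_eigenvalue A (tnth gamma i) /\
          symplectic_eigenpair A (tnth gamma i) (tnth u i) (tnth v i)].
Proof.
have [|u' [v' [g' hs']]] := exists_williamson_system (k := k) hA hinv.
  by rewrite hk.
have [u [v [g [hs sg]]]] := williamson_system_sorted hs'.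
case: (hs) => hUg hAg hJ.
exists [tuple u i | i < k], [tuple v i | i < k], g; split=> //; first split.
(* A free family of 2k vectors of [U] is a basis, as [U] has dimension 2k. *)
- rewrite basisEfree (system_free hs) size_cat !size_tuple hk mul2n -addnn leqnn.
  rewrite andbT; apply/span_subvP => x; rewrite mem_cat.
  by case/orP => /mapP[i _ ->]; have [] := hUg i.
- by move=> i; rewrite !tnth_mktuple; have [-> _ _] := hJ i i; rewrite eqxx.
- move=> i j ij; rewrite !tnth_mktuple.
  by have [-> -> ->] := hJ i j; rewrite (negPf ij).
- move=> i; rewrite !tnth_mktuple.
  (* Both vectors are non-zero because their pairing is 1. *)
  have pair : symplectic_eigenpair A (tnth g i) (u i) (v i).
    have [[hu hv] [uv _ _]] := (hAg i, hJ i i); split=> //.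
      apply: contra_eqN uv => /eqP->.
      by rewrite /inner trmx0 mul0mx mxE eqxx eq_sym oner_eq0.
    apply: contra_eqN uv => /eqP->.
    by rewrite /inner !mulmx0 mxE eqxx eq_sym oner_eq0.
  (* Being a symplectic eigenvalue refers to a spectrum on the whole space, which [williamson]
     supplies; the pair then places its value in that spectrum. *)
  split=> //; have [d hd] := williamson hA; exists d; split=> //.
  by apply: (eigenpair_mem_spectrum hd _ pair); have [] := hUg i.
Qed.
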